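(* For every $n\in\mathbb{N}_{>0}$, $\operatorname{U}(n)\vee\operatorname{P}(n)\vee\operatorname{C}(n)$. The three cases are mutually exclusive.
   Context: The domain is $\mathbb{N}_{>0}$, the positive integers, and the logic is intuitionistic ($\neg A$ abbreviates $A\to\bot$). For $a,b,n\in\mathbb{N}_{>0}$ let $R(a,b,n)$ mean $a>1\wedge b>1\wedge ab=n$. The unit, composite and prime predicates on $\mathbb{N}_{>0}$ are: $\operatorname{U}(n)\iff n=1$; $\operatorname{C}(n)\iff\exists a,b\le n\,R(a,b,n)$; $\operatorname{P}(n)\iff n>1\wedge\forall a,b\le n\,\neg R(a,b,n)$. Equality, order and multiplication on $\mathbb{N}$ are decidable/total, and finite bounded searches may use this. *)

(* Defs.v *)
(* Stdlib; Stdlib's [positive] is the domain of positive integers. *)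
From Stdlib Require Export PArith.

Local Open Scope positive_scope.

Definition R (a b n : positive) : Prop := a > 1 /\ b > 1 /\ a * b = n.

Definition U (n : positive) : Prop := n = 1.

Definition C (n : positive) : Prop :=
  exists a b : positive, a <= n /\ b <= n /\ R a b n.

Definition P (n : positive) : Prop :=
  n > 1 /\ forall a b : positive, a <= n -> b <= n -> ~ R a b n.

(* Main.v *)
Require Import Defs.
From Stdlib Require Import Lia.

Local Open Scope positive_scope.

(** The trichotomy is constructive because compositeness is a bounded search.
    The relation [R a b n] is decidable, being built from order and equality on
    [positive], and decidability passes to bounded existential quantifiers
    ([bounded_search]). Two nested searches over the candidate factors up to
    [n] either produce a factorisation, so that [n] is composite, or refute
    every one; in the latter case [n] is prime as soon as it differs from [1].
    For exclusivity, a prime is greater than [1] and has by definition no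
    factorisation of the kind that makes a number composite, while a composite
    number is at least as large as a factor greater than [1], hence not [1]. *)

(** The refuted case is given as a universal statement rather than a negated
    existential, which is the form in which primality asks for it. Induction on
    the bound suffices: raising it to its successor adds one candidate. *)
Lemma bounded_search (A : positive -> Prop) (m : positive) :
  (forall k, A k \/ ~ A k) ->
  (exists k, k <= m /\ A k) \/ (forall k, k <= m -> ~ A k).
Proof.
  intros A_dec.
  induction m as [|m IH] using Pos.peano_ind.
  - destruct (A_dec 1) as [A1 | nA1].
    + left. exists 1. split; [lia | exact A1].
    + right. intros k k_le. replace k with 1 by lia. exact nA1.
  - destruct IH as [[k [k_le Ak]] | none].
    + left. exists k. split; [lia | exact Ak].
    + destruct (A_dec (Pos.succ m)) as [Am | nAm].
      * left. exists (Pos.succ m). split; [lia | exact Am].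
      * right. intros k k_le.
        destruct (Pos.eq_dec k (Pos.succ m)) as [-> | k_ne]; [exact nAm |].
        apply none. lia.
Qed.

Lemma R_dec (a b n : positive) : R a b n \/ ~ R a b n.
Proof.
  unfold R.
  destruct (Pos.eq_dec (a * b) n); [| tauto].
  assert (gt1_dec : forall k, k > 1 \/ ~ k > 1) by (intros k; lia).
  destruct (gt1_dec a); destruct (gt1_dec b); tauto.
Qed.

Lemma composite_or_no_factorisation (n : positive) :
  C n \/ forall a b, a <= n -> b <= n -> ~ R a b n.
Proof.
  destruct (bounded_search (fun a => exists b, b <= n /\ R a b n) n)
    as [[a [a_le [b [b_le Rab]]]] | none].
  - intros a.
    destruct (bounded_search (fun b => R a b n) n) as [found | none].
    + intros b. apply R_dec.
    + left. exact found.
    + right. intros [b [b_le Rab]]. exact (none b b_le Rab).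
  - left. exists a, b. auto.
  - right. intros a b a_le b_le Rab. apply (none a a_le). exists b. auto.
Qed.

Lemma composite_gt_1 (n : positive) : C n -> n > 1.
Proof.
  intros [a [b [a_le [_ [a_gt1 _]]]]]. lia.
Qed.

Theorem theorem2p2p2 (n : positive) :
  (U n \/ P n \/ C n) /\
  (~ (U n /\ P n) /\ ~ (U n /\ C n) /\ ~ (P n /\ C n)).
Proof.
  split; [| repeat split].
  - destruct (Pos.eq_dec n 1) as [n1 | n_ne1]; [left; exact n1 | right].
    destruct (composite_or_no_factorisation n) as [Cn | none].
    + right. exact Cn.
    + left. split; [lia | exact none].
  - intros [n1 [n_gt1 _]]. unfold U in n1. lia.
  - intros [n1 Cn]. apply composite_gt_1 in Cn. unfold U in n1. lia.
  - intros [[_ none] [a [b [a_le [b_le Rab]]]]].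
    exact (none a b a_le b_le Rab).
Qed.
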